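(* Let $n\ge 3$, let $\mathbb{K}$ be a field, and let $\mathbb{G}$ be a strongly connected digraph on $n$ vertices (equivalently, let its Laplacian $L$ be an $n\times n$ ICB matrix). Let $\mathcal{L}\subset\mathbb{Z}^n$ be the lattice spanned by the columns of $L$, let $I(\mathcal{L})\subset\mathbb{K}[x]=\mathbb{K}[x_1,\dots,x_n]$ be its lattice ideal, and let $\mathcal{C}_{\mathbb{G}}=(\mathcal{C}_k,\partial_k)$ be the associated Cyc complex. Then $$0\leftarrow \mathbb{K}[x]/I(\mathcal{L})\xleftarrow{\ \partial_0\ }\mathcal{C}_0=\mathbb{K}[x]\xleftarrow{\ \partial_1\ }\mathcal{C}_1=\mathbb{K}[x]^{r_1}\xleftarrow{\ \partial_2\ }\cdots\xleftarrow{\ \partial_{n-1}\ }\mathcal{C}_{n-1}=\mathbb{K}[x]^{r_{n-1}}\leftarrow 0$$ is a free resolution of $\mathbb{K}[x]/I(\mathcal{L})$ (i.e. it is an exact complex), where $\partial_0$ is the natural projection.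
   Context: **Digraphs and matrices.** A digraph $\mathbb{G}$ is a finite directed graph with vertices $v_1,\dots,v_n$, whose arcs are ordered pairs $(v_i,v_j)$ with $i\ne j$, each arc carrying a positive integer weight, and with no sources and no sinks (every vertex has at least one incoming and at least one outgoing arc). For $i\neq j$ let $a_{i,j}$ be the weight of the arc $(v_i,v_j)$, and $a_{i,j}=0$ if there is no such arc; put $a_{i,i}=\sum_{j\ne i}a_{i,j}$. The Laplacian $L$ is the $n\times n$ matrix with diagonal entries $a_{i,i}$ and off-diagonal entries $-a_{i,j}$. The Laplacians of digraphs are exactly the CB matrices: integer matrices with diagonal entries $a_{i,i}>0$, off-diagonal entries $-a_{i,j}$ with $a_{i,j}\ge0$, $a_{i,i}=\sum_{j\neq i}a_{i,j}$, and at least one nonzero off-diagonal entry in each column. $\mathbb{G}$ is strongly connected if any two distinct vertices can be joined by a directed path (in each direction); equivalently $L$ is irreducible (there is no partition of $[n]=\{1,\dots,n\}$ into non-empty sets $I,J$ with $a_{i,j}=0$ for all $i\in I$, $j\in J$). An irreducible CB matrix is called an ICB matrix. **Lattice ideal.** $I(\mathcal{L})=(x^{l^+}-x^{l^-}\mid l\in\mathcal{L})$, where $l=l^+-l^-$ with $l^+=\max(l,0)$, $l^-=-\min(l,0)$ componentwise. **Cyc complex.** For disjoint $I,J\subseteq[n]$ put $x^{I\to J}=\prod_{i\in I}x_i^{\sum_{j\in J}a_{i,j}}$ (equal to $1$ if $I$ or $J$ is empty). $\mathrm{Cyc}_{n,k}$ is the set of cyclically ordered partitions of $[n]$ into $k$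 non-empty blocks, each represented uniquely as $(I_1,\dots,I_k)$ with $n\in I_k$. For $0\le k\le n-1$, $\mathcal{C}_k$ is the free $\mathbb{K}[x]$-module with basis $\mathrm{Cyc}_{n,k+1}$, of rank $r_k=|\mathrm{Cyc}_{n,k+1}|$; $\mathcal{C}_0=\mathbb{K}[x]$ with $([n])$ identified with $1$. The map $\partial_k:\mathcal{C}_k\to\mathcal{C}_{k-1}$ ($1\le k\le n-1$) is the $\mathbb{K}[x]$-linear map with $$\partial_k(I_1,\dots,I_{k+1})=\sum_{s=1}^{k}(-1)^{s-1}x^{I_s\to I_{s+1}}(I_1,\dots,I_s\cup I_{s+1},\dots,I_{k+1})-x^{I_{k+1}\to I_1}(I_2,\dots,I_k,I_1\cup I_{k+1}).$$ *)

(* Defs.v *)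
From HB Require Import structures.
From mathcomp Require Import all_boot all_order all_algebra.
From mathcomp Require Import mpoly boolp.

Set Implicit Arguments.
Unset Strict Implicit.
Unset Printing Implicit Defensive.

Import Order.TTheory GRing.Theory Num.Theory.
Local Open Scope ring_scope.
Local Open Scope quotient_scope.

(* Digraphs and their Laplacians. [weight i j] is a_{i,j} for i != j, and is  *)
(* 0 when there is no arc. The diagonal entries a_{i,i} of the Laplacian are  *)
(* not weights of arcs: they only appear in [laplacian].                      *)
Record digraph (n : nat) := Digraph {
  weight : 'I_n -> 'I_n -> nat;
  no_loop : forall i, weight i i = 0%N;
  no_source : forall j, exists i, (0 < weight i j)%N;
  no_sink : forall i, exists j, (0 < weight i j)%N
}.

Definition arc n (G : digraph n) : rel 'I_n :=
  [rel i j | (0 < weight G i j)%N].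

Definition strongly_connected n (G : digraph n) : Prop :=
  forall i j : 'I_n, i != j -> connect (arc G) i j.

Definition laplacian n (G : digraph n) : 'M[int]_n :=
  \matrix_(i, j) if i == j then (\sum_(k | k != i) weight G i k)%N%:Z
                 else - (weight G i j)%:Z.

Definition column_lattice n (L : 'M[int]_n) (l : 'cV[int]_n) : Prop :=
  exists z : 'cV[int]_n, l = L *m z.

Definition ideal_span (R : comNzRingType) (S : R -> Prop) (p : R) : Prop :=
  exists (m : nat) (c g : 'I_m -> R),
    (forall i, S (g i)) /\ p = \sum_i c i * g i.

Definition lattice_binomial (K : fieldType) n (l : 'cV[int]_n) : {mpoly K[n]} :=
  \prod_i 'X_i ^+ absz (Num.max (l i ord0) 0)
  - \prod_i 'X_i ^+ absz (- Num.min (l i ord0) 0).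

Definition lattice_ideal (K : fieldType) n (L : 'M[int]_n) :
    {pred {mpoly K[n]}} :=
  fun p => `[< ideal_span (fun q => exists2 l, column_lattice L l &
                                      q = lattice_binomial K l) p >].
Arguments lattice_ideal K {n} L _.

Lemma lattice_ideal_closed (K : fieldType) n (L : 'M[int]_n) :
  idealr_closed (lattice_ideal K L).
Proof.
split.
- apply/asboolP; exists 0%N, (fun=> 0), (fun=> 0).
  by split=> [[]|] //; rewrite big_ord0.
- apply/negP => /asboolP[m [c [g [gS /(congr1 (meval (fun=> 1)))]]]].
  rewrite meval1 raddf_sum big1 => [/eqP|i _]; first by rewrite oner_eq0.
  have [l _ ->] := gS i.
  rewrite /= mevalM mevalB !rmorph_prod /= !big1 ?subrr ?mulr0 // => j _;
  by rewrite rmorphXn /= mevalXU expr1n.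
move=> a u v /asboolP[m [c [g [gS ->]]]] /asboolP[m' [c' [g' [gS' ->]]]].
apply/asboolP; exists (m + m')%N.
exists (fun i => match split i with inl j => a * c j | inr j => c' j end).
exists (fun i => match split i with inl j => g j | inr j => g' j end).
split=> [i|]; first by case: (split i).
rewrite big_split_ord mulr_sumr; congr (_ + _); apply: eq_bigr => i _.
  by rewrite (unsplitK (inl i)) mulrA.
by rewrite (unsplitK (inr i)).
Qed.

HB.instance Definition _ (K : fieldType) n (L : 'M[int]_n) :=
  isIdealr.Build {mpoly K[n]} (lattice_ideal K L) (lattice_ideal_closed K L).

Section QuotientModule.
Variables (R : comNzRingType) (I : idealr R).

Definition ideal_quot_scale (a : R) (x : {ideal_quot I}) : {ideal_quot I} :=
  \pi_({ideal_quot I}) a * x.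

Fact ideal_quot_scaleA a b x :
  ideal_quot_scale a (ideal_quot_scale b x) = ideal_quot_scale (a * b) x.
Proof. by rewrite /ideal_quot_scale rmorphM mulrA. Qed.
Fact ideal_quot_scale1 : left_id 1 ideal_quot_scale.
Proof. by move=> x; rewrite /ideal_quot_scale rmorph1 mul1r. Qed.
Fact ideal_quot_scaleDr : right_distributive ideal_quot_scale +%R.
Proof. by move=> a x y; rewrite /ideal_quot_scale mulrDr. Qed.
Fact ideal_quot_scaleDl x : {morph ideal_quot_scale^~ x : a b / a + b}.
Proof. by move=> a b; rewrite /ideal_quot_scale rmorphD mulrDl. Qed.

HB.instance Definition _ :=
  GRing.Zmodule_isLmodule.Build R {ideal_quot I} ideal_quot_scaleA
    ideal_quot_scale1 ideal_quot_scaleDr ideal_quot_scaleDl.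

End QuotientModule.

(* [{ffun B -> R^o}] is the free R-module with finite basis B; [basis_vec b]  *)
(* is the basis element b, and [free_ext g] the linear map sending it to g b. *)
Section FreeModules.
Variables (R : comNzRingType) (B : finType).

Definition basis_vec (b : B) : {ffun B -> R^o} := [ffun b' => (b' == b)%:R].

Definition free_ext (M : lmodType R) (g : B -> M) (f : {ffun B -> R^o}) : M :=
  \sum_b (f b : R) *: g b.

Fact free_ext_is_linear (M : lmodType R) (g : B -> M) : linear (free_ext g).
Proof.
move=> a u v; rewrite /free_ext scaler_sumr -big_split; apply: eq_bigr => b _.
by rewrite !ffunE scalerDl scalerA.
Qed.

HB.instance Definition _ (M : lmodType R) (g : B -> M) :=
  GRing.isLinear.Build R {ffun B -> R^o} M _ (free_ext g)
    (free_ext_is_linear g).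

End FreeModules.

Definition exact (A B C : nmodType) (f : A -> B) (g : B -> C) : Prop :=
  forall b : B, g b = 0 <-> exists a : A, f a = b.

(* 0 <- M <- F_0 <- F_1 <- ... <- F_len <- 0, where F_k is free on B k,       *)
(* [d k] is the differential F_{k+1} -> F_k and [aug] is F_0 -> M. Only the   *)
(* maps up to F_len matter.                                                   *)
Definition free_resolution (R : comNzRingType) (M : lmodType R) (len : nat)
    (B : nat -> finType)
    (d : forall k, {linear {ffun B k.+1 -> R^o} -> {ffun B k -> R^o}})
    (aug : {linear {ffun B 0%N -> R^o} -> M}) : Prop :=
  [/\ forall m : M, exists f, aug f = m,
      (0 < len)%N -> exact (d 0%N) aug,
      forall k, (k.+1 < len)%N -> exact (d k.+1) (d k)
    & if len is l.+1 then injective (d l) else injective aug].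

(* Cyclically ordered partitions of the vertex set into k blocks, written     *)
(* (I_1, ..., I_k) with the last vertex (of index n - 1 here) in I_k.         *)
Definition is_cyc n k (t : k.-tuple {set 'I_n}) : bool :=
  [&& uniq t, partition [set:: t] [set: 'I_n]
    & [exists i in last set0 t, i.+1 == n :> nat]].

Record cyc n k := Cyc { blocks :> k.-tuple {set 'I_n}; _ : is_cyc blocks }.

HB.instance Definition _ n k := [isSub for @blocks n k].
HB.instance Definition _ n k := [Finite of cyc n k by <:].

(* (I_1, ..., I_s :|: I_(s+1), ..., I_(k+2)), with s counted from 0           *)
Definition merge_blocks n k (c : cyc n k.+2) (s : 'I_k.+1) :
    k.+1.-tuple {set 'I_n} :=
  [tuple if (i < s)%N then nth set0 c i
         else if i == s then nth set0 c s :|: nth set0 c s.+1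
         else nth set0 c i.+1 | i < k.+1].

(* (I_2, ..., I_(k+1), I_1 :|: I_(k+2))                                       *)
Definition wrap_blocks n k (c : cyc n k.+2) : k.+1.-tuple {set 'I_n} :=
  [tuple if (i < k)%N then nth set0 c i.+1
         else nth set0 c 0 :|: nth set0 c k.+1 | i < k.+1].

Lemma is_cycP n k (t : k.+1.-tuple {set 'I_n}) :
  reflect [/\ forall i : 'I_k.+1, tnth t i != set0,
              forall x, exists i : 'I_k.+1, x \in tnth t i,
              forall (i j : 'I_k.+1) x,
                x \in tnth t i -> x \in tnth t j -> i = j
            & exists2 x : 'I_n, x \in tnth t ord_max & x.+1 = n]
          (is_cyc t).
Proof.
have lastE : last set0 t = tnth t ord_max.
  by rewrite (tnth_nth set0) -nth_last size_tuple.
rewrite /is_cyc lastE; apply: (iffP and3P).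
- case=> ut /and3P[/eqP cv tr s0] /exists_inP[x xl /eqP xn]; split.
  + move=> i; apply: contraNneq s0 => <-; rewrite inE; exact: mem_tnth.
  + move=> x'; have : x' \in cover [set:: t] by rewrite cv inE.
    case/bigcupP=> A; rewrite inE => /tnthP[i ->] xA; by exists i.
  + move=> i j y yi yj; have /trivIsetP tr' := tr.
    have := tr' (tnth t i) (tnth t j); rewrite !inE !mem_tnth => /(_ isT isT).
    have [/eqP|_ /(_ isT) dj] := eqVneq (tnth t i) (tnth t j).
      rewrite !(tnth_nth set0) nth_uniq ?size_tuple // => /eqP e _.
      exact: val_inj.
    by have := disjointFr dj yi; rewrite yj.
  + by exists x.
- case=> ne cv tr [x xl xn]; split.
  + apply/(uniqP set0) => i j; rewrite !inE size_tuple => ik jk e.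
    have /set0Pn[y yi] := ne (Ordinal ik).
    have yj : y \in tnth t (Ordinal jk).
      by move: yi; rewrite !(tnth_nth set0) /= e.
    by have [] := tr _ _ _ yi yj.
  + apply/and3P; split.
    * apply/eqP/setP => y; rewrite inE; apply/bigcupP.
      have [i yi] := cv y; exists (tnth t i) => //; by rewrite inE mem_tnth.
    * apply/trivIsetP => A B; rewrite !inE => /tnthP[i ->] /tnthP[j ->] ij.
      rewrite disjoint_subset; apply/subsetP => y yi; rewrite inE.
      by apply: contraNN ij => yj; rewrite (tr _ _ _ yi yj).
    * rewrite inE; apply/negP => /tnthP[i e]; have := ne i; by rewrite -e eqxx.
  + by apply/exists_inP; exists x => //; apply/eqP.
Qed.

(* Amalgamating blocks along a surjective map of indices. *)
Lemma is_cyc_fusion n k (c : cyc n k.+2) (h : 'I_k.+2 -> 'I_k.+1)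
    (t : k.+1.-tuple {set 'I_n}) :
  h ord_max = ord_max -> (forall i, exists j, h j = i) ->
  (forall i x, (x \in tnth t i) <-> exists2 j, h j = i & x \in tnth c j) ->
  is_cyc t.
Proof.
case: c => c /= /is_cycP[ne cv tr [x xl xn]] hmax hsurj tE.
apply/is_cycP; split.
- move=> i; have [j hj] := hsurj i; have /set0Pn[y yj] := ne j.
  by apply/set0Pn; exists y; apply/tE; exists j.
- by move=> y; have [j yj] := cv y; exists (h j); apply/tE; exists j.
- by move=> i i' y /tE[j <- yj] /tE[j' <- yj']; rewrite (tr _ _ _ yj yj').
- by exists x => //; apply/tE; exists ord_max.
Qed.

Lemma merge_blocksP n k (c : cyc n k.+2) (s : 'I_k.+1) :
  is_cyc (merge_blocks c s).
Proof.
have hP (j : 'I_k.+2) : ((if j <= s then val j else j.-1) < k.+1)%N.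
  have := ltn_ord s; have := ltn_ord j; case: (leqP j s) => js jk sk.
    exact: leq_ltn_trans js sk.
  by case: (j : nat) js jk.
have nthE (j : 'I_k.+2) : tnth c j = nth set0 c j by rewrite (tnth_nth set0).
apply: (@is_cyc_fusion _ _ c (fun j => Ordinal (hP j))).
- apply: val_inj => /=; case: leqP => // ks.
  by have := leq_ltn_trans ks (ltn_ord s); rewrite ltnn.
- move=> i; have [is_|si] := leqP i s.
    by exists (widen_ord (leqnSn _) i); apply: val_inj; rewrite /= is_.
  by exists (lift ord0 i); apply: val_inj; rewrite /= /bump /= add1n
     leqNgt ltnS (ltnW si).
- move=> i x; rewrite tnth_mktuple; split.
  + case: ltnP => [is_ xi|si].
      exists (widen_ord (leqnSn _) i); first by apply: val_inj; rewrite /= ltnW.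
      by rewrite nthE.
    have [->|nis] := eqVneq i s.
      rewrite inE => /orP[] xi.
        exists (widen_ord (leqnSn _) s); first by apply: val_inj; rewrite /= leqnn.
        by rewrite nthE.
      exists (lift ord0 s); last by rewrite nthE.
      by apply: val_inj; rewrite /= /bump /= add1n ltnn.
    move=> xi; exists (lift ord0 i); last by rewrite nthE.
    by apply: val_inj; rewrite /= /bump /= add1n leqNgt ltnS si.
  + case=> j <- /=; rewrite nthE -val_eqE /= => xj.
    case: (leqP j s) => [js|sj] /=.
      by case: ltngtP js => // e _; rewrite inE -e xj.
    have j0 : (j.-1.+1 = j)%N by rewrite prednK // (leq_ltn_trans _ sj).
    rewrite ltnNge -ltnS j0 sj /=; case: eqP => // e.
    by rewrite inE -e j0 xj orbT.
Qed.

Definition merge n k (c : cyc n k.+2) (s : 'I_k.+1) : cyc n k.+1 :=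
  Cyc (merge_blocksP c s).

Lemma wrap_blocksP n k (c : cyc n k.+2) : is_cyc (wrap_blocks c).
Proof.
have hP (j : 'I_k.+2) : ((if j == 0%N :> nat then k else j.-1) < k.+1)%N.
  by have := ltn_ord j; case: (j : nat).
have nthE (j : 'I_k.+2) : tnth c j = nth set0 c j by rewrite (tnth_nth set0).
apply: (@is_cyc_fusion _ _ c (fun j => Ordinal (hP j))).
- exact: val_inj.
- by move=> i; exists (lift ord0 i); apply: val_inj.
- move=> i x; rewrite tnth_mktuple; split.
  + case: ltnP => [ik xi|ki].
      by exists (lift ord0 i); [apply: val_inj | rewrite nthE].
    have ei : i = k :> nat by apply/eqP; rewrite eqn_leq ki -ltnS ltn_ord.
    rewrite inE => /orP[] xi.
      by exists ord0; [apply: val_inj | rewrite nthE].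
    by exists ord_max; [apply: val_inj | rewrite nthE].
  + case=> j <- /=; rewrite nthE => xj.
    case: eqP => [e|/eqP]; first by rewrite ltnn inE -e xj.
    rewrite -lt0n => j0; have := ltn_ord j; rewrite -(prednK j0) ltnS /= => jk.
    case: ltnP => [_|kj]; first by rewrite prednK.
    have e : j = k.+1 :> nat.
      by rewrite -(prednK j0); congr _.+1; apply/eqP; rewrite eqn_leq kj -ltnS jk.
    by move: xj; rewrite e inE => ->; rewrite orbT.
Qed.

Definition wrap n k (c : cyc n k.+2) : cyc n k.+1 := Cyc (wrap_blocksP c).

Section CycComplex.
Variables (K : fieldType) (n : nat) (G : digraph n).
Local Notation R := {mpoly K[n]}.

(* x^{I -> J} *)
Definition flow_monomial (I J : {set 'I_n}) : R :=
  \prod_(i in I) 'X_i ^+ (\sum_(j in J) weight G i j)%N.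

Definition cyc_boundary k (c : cyc n k.+2) : {ffun cyc n k.+1 -> R^o} :=
  \sum_(s < k.+1)
     ((-1) ^+ s * flow_monomial (nth set0 c s) (nth set0 c s.+1))
       *: basis_vec R (merge c s)
  - flow_monomial (nth set0 c k.+1) (nth set0 c 0) *: basis_vec R (wrap c).

(* [cyc_diff k] is the differential C_{k+1} -> C_k, as C_k is free on         *)
(* [cyc n k.+1]; the sign (-1) ^ (s - 1) becomes (-1) ^+ s as s starts at 0.  *)
Definition cyc_diff k :
    {linear {ffun cyc n k.+2 -> R^o} -> {ffun cyc n k.+1 -> R^o}} :=
  free_ext (@cyc_boundary k).

(* [cyc n 1] has ([n]) as its only element (see [card_cyc1]), so summing the  *)
(* coordinates identifies the free module on it with K[x], ([n]) being 1.     *)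
Definition cyc0_poly (f : {ffun cyc n 1 -> R^o}) : R := \sum_c (f c : R).

Definition cyc_proj (f : {ffun cyc n 1 -> R^o}) :
    {ideal_quot (lattice_ideal K (laplacian G))} :=
  \pi_({ideal_quot (lattice_ideal K (laplacian G))}) (cyc0_poly f).

Fact cyc_proj_is_linear : linear cyc_proj.
Proof.
move=> a u v; rewrite /cyc_proj /cyc0_poly.
under eq_bigr do rewrite !ffunE.
by rewrite big_split -mulr_sumr /= rmorphD rmorphM.
Qed.

HB.instance Definition _ :=
  GRing.isLinear.Build R {ffun cyc n 1 -> R^o}
    {ideal_quot (lattice_ideal K (laplacian G))} _ cyc_proj cyc_proj_is_linear.

End CycComplex.

Lemma cyc1_blocks n (c : cyc n 1) : blocks c = [tuple setT].
Proof.
case: c => t /= /is_cycP[_ cv _ _]; apply/eq_from_tnth => i.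
apply/setP => x; have [j] := cv x.
by rewrite !ord1 tnth0 inE => ->.
Qed.

Lemma card_cyc1 n : (0 < n)%N -> #|{: cyc n 1}| = 1%N.
Proof.
case: n => // n _.
have P : @is_cyc n.+1 1 [tuple setT].
  apply/is_cycP; split=> [i|x|i j x _ _|]; rewrite ?ord1 ?tnth0.
  - by apply/set0Pn; exists ord0; rewrite inE.
  - by exists ord0; rewrite inE.
  - by [].
  - by exists ord_max; rewrite ?inE.
apply: eq_card1 (Cyc P) _ _ => c; rewrite !inE; apply/esym/eqP.
by apply: val_inj; exact: cyc1_blocks.
Qed.

(* Main.v *)
Require Import Defs.
From HB Require Import structures.
From mathcomp Require Import all_boot all_order all_algebra.
From mathcomp Require Import zify.
From mathcomp Require Import mpoly boolp.

Set Implicit Arguments.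
Unset Strict Implicit.
Unset Printing Implicit Defensive.

(* Split the complex by degree in Z^n / L(Z^n). In the degree of a monomial     *)
(* x^u, an ordered partition (I_1, ..., I_(k+1)) together with a monomial       *)
(* coefficient is the same thing as a flag A_1 < ... < A_k (A_s the union of    *)
(* I_1, ..., I_s) of nonempty sets of vertices avoiding the last vertex, each   *)
(* of which can be fired legally from u, i.e. u - L e_(A_s) >= 0. Merging       *)
(* blocks deletes a member of the flag, while the wrap-around face replaces u   *)
(* by u - L e_(A_1). Legal sets are closed under union, so u has a greatest     *)
(* legal set A(u), and all legal flags of u lie below it: adding A(u) on top    *)
(* of a flag is a contracting homotopy up to terms in which u has been fired.   *)
(* As every vertex has a path to the last one, only finitely many firings are   *)
(* possible from u, and the remaining terms die after finitely many rounds.     *)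
(* In degree zero, x^u - x^v with u - v = L z and z >= 0 is a boundary by       *)
(* induction on max z: fire first the set where z is maximal.                   *)

(** Over the field, the complex has the basis of all [cell K G c u] with [label G c <= u], and this
    inequality says precisely that the flag of [c] consists of sets legal from [u]. By [cell_diff],
    all faces but the wrap-around one stay at [u]. So, up to terms in which [u] has been fired, the
    differential is that of the augmented chain complex of flags in a poset with greatest element
    [max_legal G u], which is a cone and hence contractible.

    The cone construction is [contract], and [defectE] computes its failure to be a homotopy from
    the identity to zero: the error terms live at degrees reached from [u] by one legal firing
    ([based_defect]). Strong connectedness bounds the number of firings ([terminates_ex]), so
    correcting a cycle by the homotopy finitely often leaves zero ([acyclic_based]). Injectivity of
    the top differential is the same statement, since no partition has more than [n] blocks.

    At the augmentation, boundaries of cells are differences of monomials related by one firing.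
    They lie in the lattice ideal because firing subtracts a lattice vector ([boundary_binomial]).
    Conversely every lattice binomial telescopes into legal firings ([is_boundary_equiv]). *)

Import Order.TTheory GRing.Theory Num.Theory.
Local Open Scope ring_scope.
Local Open Scope quotient_scope.
Local Notation merge := Defs.merge.
Local Notation wrap := Defs.wrap.
Local Notation arc := Defs.arc.

(** * Block indices *)

Section BlockIndex.
Variable n : nat.

(** An ordered partition is handled through its rank function, so that identities between [merge],
    [wrap] and splitting become arithmetic on block indices. *)
Definition blk k (c : cyc n k) (i : 'I_n) : nat :=
  find (fun B : {set 'I_n} => i \in B) c.

Lemma mem_blk k (c : cyc n k.+1) s i : (i \in nth set0 c s) = (blk c i == s).
Proof.
have /is_cycP[_ cv tr _] := valP c; have [b ib] := cv i.
have nthE (t : 'I_k.+1) : tnth c t = nth set0 c t by rewrite (tnth_nth set0).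
have hasi : has (fun B : {set 'I_n} => i \in B) c.
  by apply/hasP; exists (tnth c b); rewrite ?mem_tnth.
have ltf : (blk c i < k.+1)%N by have := hasi; rewrite has_find size_tuple.
apply/idP/eqP => [is_|<-]; last exact: (nth_find set0 hasi).
have ltsk : (s < k.+1)%N.
  by rewrite ltnNge; apply: contraL is_ => le; rewrite nth_default ?inE ?size_tuple.
have := tr (Ordinal ltf) (Ordinal ltsk) i; rewrite !nthE => /(_ _ is_) e.
by have /(congr1 val) := e (nth_find set0 hasi).
Qed.

Lemma blk_lt k (c : cyc n k.+1) i : (blk c i < k.+1)%N.
Proof.
have /is_cycP[_ cv _ _] := valP c; have [b] := cv i.
by rewrite (tnth_nth set0) mem_blk => /eqP ->.
Qed.

Lemma blk_le k (c : cyc n k.+1) i : (blk c i <= k)%N.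
Proof. by have := blk_lt c i. Qed.

Lemma blk_inj k (c c' : cyc n k.+1) : blk c =1 blk c' -> c = c'.
Proof.
move=> e; apply/val_inj/eq_from_tnth => s; apply/setP => i.
by rewrite !(tnth_nth set0) !mem_blk e.
Qed.

Lemma blk_surj k (c : cyc n k.+1) s : (s <= k)%N -> exists i, blk c i = s.
Proof.
move=> sk; have /is_cycP[ne _ _ _] := valP c.
have /set0Pn[i] := ne (Ordinal (sk : (s < k.+1)%N)).
by rewrite (tnth_nth set0) mem_blk => /eqP; exists i.
Qed.

Lemma blk_last k (c : cyc n k.+1) (i : 'I_n) : i.+1 = n -> blk c i = k.
Proof.
have /is_cycP[_ _ _ [x xm xn]] := valP c => ni.
have <- : x = i by apply/val_inj/succn_inj; rewrite xn ni.
by apply/eqP; rewrite -mem_blk; move: xm; rewrite (tnth_nth set0).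
Qed.

Definition cyc_of k (r : 'I_n -> nat) : option (cyc n k) :=
  insub [tuple [set i | r i == s] | s < k].

Lemma blk_cyc_of k r (c : cyc n k.+1) : cyc_of k.+1 r = Some c -> blk c =1 r.
Proof.
rewrite /cyc_of; case: insubP => // c' _ e [<-{c}] i.
have := mem_blk c' (blk c' i) i; rewrite eqxx e.
have := blk_lt c' i; set b := blk c' i => bk.
rewrite (nth_map (Ordinal bk)) ?size_enum_ord // inE => /eqP ->.
by rewrite nth_enum_ord.
Qed.

Lemma blkK k r (c : cyc n k.+1) : blk c =1 r -> cyc_of k.+1 r = Some c.
Proof.
move=> e; rewrite /cyc_of.
suff -> : [tuple [set i | r i == s] | s < k.+1] = val c by rewrite valK.
apply/eq_from_tnth => s; apply/setP => i.
by rewrite tnth_mktuple inE (tnth_nth set0) mem_blk e.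
Qed.

Lemma cyc_of_some k r x :
  (forall i, r i <= k)%N -> (forall s, (s <= k)%N -> exists i, r i = s) ->
  x.+1 = n :> nat -> (forall i : 'I_n, i.+1 = n -> r i = k) ->
  exists c, cyc_of k.+1 r = Some c.
Proof.
move=> rk rs xn rl; rewrite /cyc_of; case: insubP => [c _ _|]; first by exists c.
case/negP; apply/is_cycP; split=> [s|i|s t i|].
- have [i e] := rs s (leq_ord s); apply/set0Pn; exists i.
  by rewrite tnth_mktuple inE e.
- by exists (Ordinal (rk i : (r i < k.+1)%N)); rewrite tnth_mktuple inE.
- by rewrite !tnth_mktuple !inE => /eqP e /eqP e'; apply: val_inj; rewrite /= -e -e'.
- have xn' : (x < n)%N by rewrite -xn.
  exists (Ordinal xn') => //; rewrite tnth_mktuple inE /=.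
  by rewrite (rl (Ordinal xn')).
Qed.

Lemma blk_merge k (c : cyc n k.+2) s i :
  blk (merge c s) i = if (blk c i <= s)%N then blk c i else (blk c i).-1.
Proof.
have ltb : ((if (blk c i <= s)%N then blk c i else (blk c i).-1) < k.+1)%N.
  by have := blk_lt c i; have := ltn_ord s => sk bk; case: (leqP _ s); lia.
apply/eqP; rewrite -mem_blk (nth_map (Ordinal ltb)) ?size_enum_ord //.
rewrite -[X in nth _ _ X]/(val (Ordinal ltb)) nth_ord_enum /=.
rewrite -(inj_eq val_inj) /=; case: (leqP (blk c i) s) => h; case: ltngtP => h';
  rewrite ?inE !mem_blk; lia.
Qed.

Lemma blk_wrap k (c : cyc n k.+2) i :
  blk (wrap c) i = if blk c i == 0%N then k else (blk c i).-1.
Proof.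
have ltb : ((if blk c i == 0%N then k else (blk c i).-1) < k.+1)%N.
  by have bk := blk_lt c i; case: eqP => /=; lia.
apply/eqP; rewrite -mem_blk (nth_map (Ordinal ltb)) ?size_enum_ord //.
rewrite -[X in nth _ _ X]/(val (Ordinal ltb)) nth_ord_enum /=.
case: eqP => h; first by rewrite ltnn inE !mem_blk h.
by have bk := blk_lt c i; case: ltnP => ?; rewrite ?inE !mem_blk; lia.
Qed.

End BlockIndex.

(** * Firing and degrees *)

Section Firing.
Variables (n : nat) (G : digraph n).
Implicit Types (u : 'X_{1..n}) (A B : {set 'I_n}).

Definition outflow i A : nat := \sum_(j in A) weight G i j.

Lemma outflowU i A B :
  [disjoint A & B] -> outflow i (A :|: B) = (outflow i A + outflow i B)%N.
Proof. by move=> dAB; rewrite /outflow -bigU //=; apply: eq_bigl => j; rewrite !inE. Qed.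

Lemma outflowS i A B : A \subset B -> (outflow i A <= outflow i B)%N.
Proof.
move=> /subsetP sAB; rewrite /outflow big_mkcond [leqRHS]big_mkcond.
by apply: leq_sum => j _; case: ifP => // /sAB ->.
Qed.

Lemma outflow0 i : outflow i set0 = 0%N.
Proof. exact: big_set0. Qed.

Definition legal u A : bool := [forall i in A, outflow i (~: A) <= u i]%N.

Definition fire u A : 'X_{1..n} :=
  [multinom if i \in A then u i - outflow i (~: A)
            else u i + outflow i A | i < n]%N.

(** The last vertex is the sink of the chip-firing game; it lies in no member of the flag of a
    partition. *)
Definition sink_free A := [forall i in A, i.+1 != n].

Definition max_legal u : {set 'I_n} :=
  \bigcup_(A | legal u A && sink_free A) A.

Lemma legalP u A :
  reflect (forall i, i \in A -> outflow i (~: A) <= u i)%N (legal u A).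
Proof. exact: forall_inP. Qed.

Lemma max_legal_sup u A : legal u A -> sink_free A -> A \subset max_legal u.
Proof. by move=> lA sA; apply: bigcup_sup; rewrite lA. Qed.

(** Enlarging a set only decreases the outflow to its complement, so legality passes to unions. *)
Lemma max_legal_legal u : legal u (max_legal u).
Proof.
apply/legalP => i /bigcupP[A /andP[lA sA] iA].
apply: leq_trans (legalP _ _ lA i iA); apply: outflowS.
by rewrite setCS max_legal_sup.
Qed.

Lemma max_legal_sink_free u : sink_free (max_legal u).
Proof.
by apply/forall_inP => i /bigcupP[A /andP[_ /forall_inP sA] iA]; apply: sA.
Qed.

Lemma fireU u A B : [disjoint A & B] -> legal u A ->
  fire (fire u A) B = fire u (A :|: B).
Proof.
move=> dAB /legalP lA; apply/mnmP => i; rewrite !mnmE inE (outflowU _ dAB).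
have sumC C : (outflow i setT = outflow i C + outflow i (~: C))%N.
  by rewrite -outflowU ?setUCr // -setI_eq0 setICr.
have := sumC A; rewrite (sumC B) => eB; have := sumC (A :|: B).
rewrite (sumC B) outflowU // => eU; have := lA i; have := disjointFr dAB (x := i).
by case: (i \in A) => [/(_ isT) -> /(_ isT)|_ _] /=; [|case: (i \in B)]; lia.
Qed.

(* The exponent of the least common multiple of the x^(L e_(A_s)), where A_s    *)
(* runs over the flag of c, including A_0 = set0.                               *)
Definition label k (c : cyc n k) : 'X_{1..n} :=
  [multinom outflow i [set j | (blk c i < blk c j)%N] | i < n].

Lemma legal_lower_blocks k (c : cyc n k) u s :
  (label c <= u)%MM -> legal u [set i | (blk c i < s)%N].
Proof.
move=> /mnm_lepP cu; apply/legalP => i; rewrite inE => is_.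
apply: leq_trans (cu i); rewrite mnmE; apply: outflowS; apply/subsetP => j.
by rewrite !inE -leqNgt; apply: leq_trans.
Qed.

Lemma sink_free_lower_blocks k (c : cyc n k.+1) s :
  (s <= k)%N -> sink_free [set i | (blk c i < s)%N].
Proof.
move=> sk; apply/forall_inP => i; rewrite inE => is_; apply/eqP => /(blk_last c).
by move: is_; lia.
Qed.

Lemma lower_blocks_max_legal k (c : cyc n k.+1) u i :
  (label c <= u)%MM -> (blk c i < k)%N -> i \in max_legal u.
Proof.
move=> cu ik; have sf := sink_free_lower_blocks c (leqnn k).
by have /subsetP := max_legal_sup (legal_lower_blocks k cu) sf; apply; rewrite inE.
Qed.

Definition first_block k (c : cyc n k) : {set 'I_n} := [set i | blk c i == 0%N].

Lemma first_block_legal k (c : cyc n k.+2) u : (label c <= u)%MM ->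
  [/\ first_block c != set0, sink_free (first_block c) & legal u (first_block c)].
Proof.
have -> : first_block c = [set i | (blk c i < 1)%N].
  by apply/setP => i; rewrite !inE; case: (blk c i).
move=> cu; split; last exact: legal_lower_blocks.
  by have [i ci] := blk_surj c (leq0n _); apply/set0Pn; exists i; rewrite inE ci.
exact: sink_free_lower_blocks.
Qed.

Definition flow_mnm k (c : cyc n k) s t : 'X_{1..n} :=
  [multinom if blk c i == s then outflow i [set j | blk c j == t] else 0 | i < n].

(** The coefficient of a merging face makes up exactly for the drop of the label, so these faces
    preserve the degree. *)
Lemma label_merge k (c : cyc n k.+2) (s : 'I_k.+1) :
  (label (merge c s) + flow_mnm c s s.+1 = label c)%MM.
Proof.
apply/mnmP => i; rewrite !mnmE blk_merge; case: eqP => [->|nis].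
  rewrite leqnn -outflowU.
    congr outflow; apply/setP => j; rewrite !inE blk_merge.
    by case: (leqP (blk c j) s); lia.
  rewrite -setI_eq0; apply/eqP/setP => j; rewrite !inE blk_merge.
  by case: (leqP (blk c j) s); lia.
rewrite addn0; congr outflow; apply/setP => j; rewrite !inE blk_merge.
by case: (leqP (blk c j) s); case: (leqP (blk c i) s); lia.
Qed.

Lemma label_merge_le k (c : cyc n k.+2) s : (label (merge c s) <= label c)%MM.
Proof. by rewrite -(label_merge c s) lem_addr. Qed.

(** Vertices of the first block become last and lose their label, which is their outflow on firing;
    middle vertices gain their flow into the first block through the new label, and those of the
    last block through the coefficient. *)
Lemma label_wrap k (c : cyc n k.+2) u : (label c <= u)%MM ->
  (u - label c + flow_mnm c k.+1 0%N + label (wrap c) = fire u (first_block c))%MM.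
Proof.
move=> /mnm_lepP cu; apply/mnmP => i; have := cu i; rewrite !mnmE !inE.
have bi := blk_lt c i.
have wE j : (blk (wrap c) i < blk (wrap c) j)%N =
    [&& blk c i != 0%N, blk c i != k.+1
      & (blk c j == 0%N) || (blk c i < blk c j)%N].
  rewrite !blk_wrap; have bj := blk_lt c j.
  by case: (blk c i == 0%N) / eqP; case: (blk c j == 0%N) / eqP; lia.
have [i0|i0] := eqVneq (blk c i) 0%N.
  rewrite i0 /= !addn0 [X in (_ + outflow _ X)%N](_ : _ = set0).
    rewrite outflow0 addn0 => _; congr (_ - outflow _ _)%N.
    by apply/setP => j; rewrite !inE lt0n.
  by apply/setP => j; rewrite !inE wE i0.
have [ik|ik] := eqVneq (blk c i) k.+1.
  rewrite ik [X in (_ + outflow _ X)%N](_ : _ = set0); last first.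
    by apply/setP => j; rewrite !inE wE ik eqxx andbF.
  rewrite [X in (_ - outflow _ X)%N](_ : _ = set0) ?outflow0 ?subn0 ?addn0 //.
  by apply/setP => j; rewrite !inE; have := blk_lt c j; lia.
rewrite [X in (_ + outflow _ X)%N](_ : _ =
    first_block c :|: [set j | (blk c i < blk c j)%N]); last first.
  by apply/setP => j; rewrite !inE wE i0 ik.
rewrite outflowU; first by lia.
by rewrite -setI_eq0; apply/eqP/setP => j; rewrite !inE; lia.
Qed.

Lemma label_wrap_le k (c : cyc n k.+2) u : (label c <= u)%MM ->
  (label (wrap c) <= fire u (first_block c))%MM.
Proof. by move=> cu; rewrite -(label_wrap cu) lem_addl. Qed.

End Firing.

(** * Cells and the differential on them *)

Lemma scale_boundary (R : comNzRingType) (V : lmodType R) m (x z xz : R)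
    (a y xy : 'I_m -> R) (v : 'I_m -> V) (t : V) :
  (forall i, x * y i = xy i) -> x * z = xz ->
  x *: (\sum_i (a i * y i) *: v i - z *: t)
  = \sum_i a i *: (xy i *: v i) - xz *: t.
Proof.
move=> xyE <-; rewrite scalerBr scalerA scaler_sumr; congr (_ - _).
by apply: eq_bigr => i _; rewrite !scalerA mulrCA xyE.
Qed.

(* The pair of the monomial x^u and the flag of c; it only makes sense when     *)
(* [label G c <= u], as the subtraction is truncated. Locked, because           *)
(* conversion checks that unfold it do not terminate in reasonable time.        *)
HB.lock Definition cell (K : fieldType) n (G : digraph n) k (c : cyc n k)
    (u : 'X_{1..n}) : {ffun cyc n k -> {mpoly K[n]}^o} :=
  'X_[u - label G c] *: basis_vec {mpoly K[n]} c.

Section Basis.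
Variables (K : fieldType) (n : nat) (G : digraph n).
Local Notation R := {mpoly K[n]}.
Implicit Types (u : 'X_{1..n}) (A B : {set 'I_n}).

Lemma flow_monomialE (A B : {set 'I_n}) :
  flow_monomial K G A B
  = 'X_[[multinom if i \in A then outflow G i B else 0 | i < n]].
Proof.
rewrite /flow_monomial mpolyXE_id big_mkcond; apply: eq_bigr => i _; rewrite mnmE.
by case: ifP => // _; rewrite expr0.
Qed.

Lemma flow_blk k (c : cyc n k.+1) s t :
  flow_monomial K G (nth set0 c s) (nth set0 c t) = 'X_[flow_mnm G c s t].
Proof.
rewrite flow_monomialE; congr 'X_[_]; apply/mnmP => i; rewrite !mnmE mem_blk.
case: eqP => // _; congr outflow.
by apply/setP => j; rewrite inE mem_blk.
Qed.

Lemma free_ext_basis (B : finType) (M : lmodType R) (g : B -> M) b :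
  free_ext g (basis_vec R b) = g b.
Proof.
rewrite /free_ext (bigD1 b) //= ffunE eqxx scale1r big1 ?addr0 // => b' nb.
by rewrite ffunE (negPf nb) scale0r.
Qed.

Lemma cell_diff k (c : cyc n k.+2) u : (label G c <= u)%MM ->
  cyc_diff K G k (cell K G c u)
  = \sum_(s < k.+1) (-1) ^+ s *: cell K G (merge c s) u
    - cell K G (wrap c) (fire G u (first_block c)).
Proof.
move=> cu; rewrite cell.unlock linearZ /= free_ext_basis /cyc_boundary.
apply: scale_boundary => [s|]; rewrite flow_blk -mpolyXD.
  congr 'X_[_]; rewrite -(label_merge G c s) -submDA submK //.
  apply/mnm_lepP => i; rewrite mnmBE; move/mnm_lepP/(_ i): cu.
  by rewrite -(label_merge G c s) mnmDE; lia.
by congr 'X_[_]; rewrite -(label_wrap cu) addmK.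
Qed.

End Basis.

(** * Alternating sums and monomial-wise linear extension *)

Section AlternatingSums.
Variables (R : comNzRingType) (V : lmodType R).

(** The simplicial cancellation: the term at [(s, t)] with [s <= t] is paired with the one at
    [(t.+1, s)], which has the opposite sign. *)
Lemma alternating_faces k (M : nat -> nat -> V) :
  (forall s t, (s <= t <= k)%N -> M s t = M t.+1 s) ->
  \sum_(s < k.+2) (-1) ^+ s *: \sum_(t < k.+1) (-1) ^+ t *: M s t = 0.
Proof.
move=> ME; pose F s t := (-1) ^+ (s + t) *: M s t.
under eq_bigr do rewrite scaler_sumr.
rewrite (eq_bigr (fun s : 'I_k.+2 => \sum_(t < k.+1 | (s <= t)%N) F s t
    + \sum_(t < k.+1 | ~~ (s <= t)%N) F s t)); last first.
  move=> s _; rewrite (bigID (fun t : 'I_k.+1 => (s <= t)%N)) /=.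
  by congr (_ + _); apply: eq_bigr => t _; rewrite scalerA -exprD.
rewrite big_split /=.
rewrite [X in X + _]big_ord_recr /= [X in _ + X + _]big1 ?addr0; last first.
  by move=> t; rewrite leqNgt ltn_ord.
rewrite [X in _ + X]big_ord_recl /= [X in _ + (X + _)]big1 ?add0r; last first.
  by move=> t.
under eq_bigr do rewrite big_mkcond.
under [X in _ + X]eq_bigr do rewrite big_mkcond.
rewrite exchange_big -big_split big1 //= => t _; rewrite -big_split big1 //= => s _.
rewrite /bump /= add1n -ltnNge ltnS; case: ifP => [st|]; last by rewrite addr0.
rewrite /F ME ?st ?leq_ord // addSn exprS mulN1r scaleNr addnC.
by rewrite [(t + s)%N]addnC subrr.
Qed.

(** [W] stands for wrapping after a merge, [W'] for merging after a wrap, and [z] for wrapping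
    twice. *)
Lemma alternating_faces_wrap k (M : nat -> nat -> V) (W W' : nat -> V) (z : V) :
  (forall s t, (s <= t <= k)%N -> M s t = M t.+1 s) -> W 0%N = z ->
  (forall t, (t <= k)%N -> W t.+1 = W' t) ->
  \sum_(s < k.+2) (-1) ^+ s *: (\sum_(t < k.+1) (-1) ^+ t *: M s t - W s)
  - (\sum_(t < k.+1) (-1) ^+ t *: W' t - z) = 0.
Proof.
move=> ME W0 WS; under eq_bigr do rewrite scalerBr.
rewrite sumrB alternating_faces // sub0r big_ord_recl scale1r W0 opprD opprB.
rewrite addrACA addNr add0r -sumrN -sumrB big1 // => t _.
by rewrite /= /bump add1n WS ?leq_ord // exprS mulN1r scaleNr opprK subrr.
Qed.

End AlternatingSums.

Section MonomialExtension.
Variables (K : fieldType) (n : nat) (B : finType).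
Local Notation R := {mpoly K[n]}.

(** Extension that is linear over the field only: the homotopy depends on the monomial and is not
    linear over the polynomial ring. *)
Definition monomial_ext (V : lmodType R) (g : B -> 'X_{1..n} -> V)
    (f : {ffun B -> R^o}) : V :=
  \sum_b \sum_(m <- msupp (f b : R)) ((f b : R)@_m)%:MP *: g b m.

Lemma msupp_sum_widen (V : lmodType R) (g : 'X_{1..n} -> V) (p : R) s :
  uniq s -> {subset msupp p <= s} ->
  \sum_(m <- msupp p) (p@_m)%:MP *: g m = \sum_(m <- s) (p@_m)%:MP *: g m.
Proof.
move=> us sub; rewrite [RHS](bigID (mem (msupp p))) /=.
rewrite [X in _ = _ + X]big1 => [|m].
  rewrite addr0 -[RHS]big_filter; apply: perm_big; apply: uniq_perm.
  - exact: msupp_uniq.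
  - exact: filter_uniq.
  - by move=> m; rewrite mem_filter andb_idr // => /sub.
by rewrite -mcoeff_eq0 => /eqP->; rewrite mpolyC0 scale0r.
Qed.

Lemma monomial_ext_is_additive (V : lmodType R) g : additive (@monomial_ext V g).
Proof.
move=> f f'; rewrite /monomial_ext -sumrB; apply: eq_bigr => b _.
rewrite !ffunE; set p : R := f b; set q : R := f' b.
pose s := undup (msupp p ++ msupp q); have us : uniq s := undup_uniq _.
rewrite (msupp_sum_widen _ us) => [|m mp]; last first.
  by rewrite mem_undup; apply: msuppB_le.
rewrite !(msupp_sum_widen _ us) => [|m mp|m mp]; first last.
- by rewrite mem_undup mem_cat mp.
- by rewrite mem_undup mem_cat mp orbT.
rewrite -sumrB; apply: eq_bigr => m _.
by rewrite mcoeffB mpolyCB scalerBl.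
Qed.

HB.instance Definition _ (V : lmodType R) g :=
  GRing.isZmodMorphism.Build {ffun B -> R^o} V (@monomial_ext V g)
    (monomial_ext_is_additive g).

Lemma monomial_ext_monomial (V : lmodType R) (g : B -> 'X_{1..n} -> V) b m :
  monomial_ext g ('X_[m] *: basis_vec R b) = g b m.
Proof.
have e b' : ('X_[m] *: basis_vec R b) b' = 'X_[m] * (b' == b)%:R :> R.
  by rewrite !ffunE.
rewrite /monomial_ext (bigD1 b) //= [X in _ + X]big1 => [|b' nb].
  by rewrite e eqxx mulr1 addr0 msuppX big_seq1 mcoeffX eqxx scale1r.
by rewrite e (negPf nb) mulr0 msupp0 big_nil.
Qed.

Lemma monomial_ext_id f :
  monomial_ext (fun b m => 'X_[m] *: basis_vec R b) f = f.
Proof.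
have e a m b b' :
    (a%:MP *: ('X_[m] *: basis_vec R b)) b' = a *: 'X_[m] * (b' == b)%:R :> R.
  by rewrite !ffunE -mul_mpolyC -mulrA.
apply/ffunP => b; rewrite sum_ffunE (bigD1 b) //= [X in _ + X]big1 => [|b' nb].
  rewrite addr0 sum_ffunE [RHS](mpolyE (f b : R)); apply: eq_bigr => m _.
  by rewrite e eqxx mulr1.
rewrite sum_ffunE big1 // => m _.
by rewrite e eq_sym (negPf nb) mulr0.
Qed.

Lemma monomial_ext_sub (V : lmodType R) (g h : B -> 'X_{1..n} -> V) f :
  monomial_ext g f - monomial_ext h f = monomial_ext (fun b m => g b m - h b m) f.
Proof.
rewrite -sumrB; apply: eq_bigr => b _; rewrite -sumrB; apply: eq_bigr => m _.
by rewrite scalerBr.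
Qed.

Lemma monomial_extZ (V : lmodType R) (g : B -> 'X_{1..n} -> V) (a : K) f :
  monomial_ext g (a%:MP *: f) = a%:MP *: monomial_ext g f.
Proof.
rewrite /monomial_ext scaler_sumr; apply: eq_bigr => b _.
have -> : (a%:MP *: f) b = a%:MP * (f b : R) :> R by rewrite ffunE.
set p : R := f b; rewrite (msupp_sum_widen _ (msupp_uniq p)).
  rewrite scaler_sumr; apply: eq_bigr => m _.
  by rewrite scalerA -mpolyCM mcoeffCM.
move=> m; rewrite !mcoeff_msupp mcoeffCM; apply: contraNneq => ->.
by rewrite mulr0.
Qed.

Lemma monomial_ext_comp (V W : lmodType R) (phi : {additive V -> W})
    (g : B -> 'X_{1..n} -> V) f :
  (forall a v, phi (a%:MP *: v) = a%:MP *: phi v) ->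
  phi (monomial_ext g f) = monomial_ext (fun b m => phi (g b m)) f.
Proof.
move=> phiZ; rewrite raddf_sum; apply: eq_bigr => b _; rewrite raddf_sum.
by apply: eq_bigr => m _; rewrite phiZ.
Qed.

End MonomialExtension.

(** * The differential squares to zero *)

Section SquareZero.
Variables (K : fieldType) (n : nat) (G : digraph n).
Local Notation R := {mpoly K[n]}.

Lemma merge_merge k (c : cyc n k.+3) (s t : nat) : (s <= t <= k)%N ->
  merge (merge c (inord s)) (inord t) = merge (merge c (inord t.+1)) (inord s).
Proof.
case/andP=> st tk; apply: blk_inj => i; rewrite !blk_merge !inordK; try lia.
by case: (leqP (blk c i) s) => ?; case: (leqP (blk c i) t.+1) => ?;
  repeat (case: leqP => ?); lia.
Qed.

Lemma merge_wrap k (c : cyc n k.+3) (t : nat) : (t <= k)%N ->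
  wrap (merge c (inord t.+1)) = merge (wrap c) (inord t).
Proof.
move=> tk; apply: blk_inj => i; rewrite blk_wrap !blk_merge blk_wrap !inordK; try lia.
have := blk_lt c i; case: (blk c i) => [|b] /= bk.
  by case: (leqP k.+1 t); lia.
by rewrite ltnS; case: (leqP b t) => // bt; case: eqP bt => // ->.
Qed.

Lemma wrap_merge0 k (c : cyc n k.+3) : wrap (merge c ord0) = wrap (wrap c).
Proof.
apply: blk_inj => i; rewrite !blk_wrap blk_merge /=.
by have := blk_lt c i; case: (blk c i) => [|[|b]].
Qed.

Lemma first_block_merge0 k (c : cyc n k.+3) :
  first_block (merge c ord0) = first_block c :|: first_block (wrap c).
Proof.
apply/setP => i; rewrite !inE blk_merge blk_wrap /=.
by case: (blk c i) => [|[|b]].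
Qed.

Lemma first_block_mergeS k (c : cyc n k.+3) (t : nat) : (t <= k)%N ->
  first_block (merge c (inord t.+1)) = first_block c.
Proof.
move=> tk; apply/setP => i; rewrite !inE blk_merge inordK; last by lia.
by case: leqP; lia.
Qed.

Lemma fire_fire_first_block k (c : cyc n k.+3) u : (label G c <= u)%MM ->
  fire G (fire G u (first_block c)) (first_block (wrap c))
  = fire G u (first_block (merge c ord0)).
Proof.
move=> cu; rewrite first_block_merge0 fireU //.
  rewrite -setI_eq0; apply/eqP/setP => i; rewrite !inE blk_wrap.
  by case: (blk c i).
by have [] := first_block_legal cu.
Qed.

Lemma diff_diff_cell k (c : cyc n k.+3) u : (label G c <= u)%MM ->
  cyc_diff K G k (cyc_diff K G k.+1 (cell K G c u)) = 0.
Proof.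
move=> cu; rewrite cell_diff // linearB linear_sum /=.
pose M (s t : nat) := cell K G (merge (merge c (inord s)) (inord t)) u.
pose W (s : nat) := let c' := merge c (inord s) in
  cell K G (wrap c') (fire G u (first_block c')).
pose W' (t : nat) := cell K G (merge (wrap c) (inord t)) (fire G u (first_block c)).
have e (s : 'I_k.+2) : cyc_diff K G k ((-1) ^+ s *: cell K G (merge c s) u)
    = (-1) ^+ s *: (\sum_(t < k.+1) (-1) ^+ t *: M s t - W s).
  rewrite linearZ (cell_diff K (lepm_trans (label_merge_le _ _ _) cu)).
  by rewrite /W inord_val; under [in RHS]eq_bigr do rewrite /M !inord_val.
rewrite (eq_bigr _ (fun s _ => e s)) (cell_diff K (label_wrap_le cu)).
have eW' (t : 'I_k.+1) : cell K G (merge (wrap c) t) (fire G u (first_block c)) = W' t.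
  by rewrite /W' inord_val.
under [X in _ - (X - _)]eq_bigr do rewrite eW'.
apply: alternating_faces_wrap.
- by move=> s t st; rewrite /M (merge_merge _ st).
- have e0 : inord 0 = ord0 :> 'I_k.+2 by apply: val_inj; rewrite /= inordK.
  by rewrite /W e0 wrap_merge0 (fire_fire_first_block cu).
- by move=> t tk; rewrite /W /W' (merge_wrap _ tk) (first_block_mergeS _ tk).
Qed.

Lemma cell_label k (c : cyc n k) : cell K G c (label G c) = basis_vec R c.
Proof.
rewrite cell.unlock; have -> : (label G c - label G c = 0)%MM.
  by apply/mnmP => i; rewrite !mnmE subnn.
by rewrite mpolyX0 scale1r.
Qed.

Lemma diff_diff k f : cyc_diff K G k (cyc_diff K G k.+1 f) = 0.
Proof.
rewrite [cyc_diff K G k.+1 f]/(free_ext _ _) /free_ext linear_sum big1 // => c _.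
rewrite linearZ -(free_ext_basis (cyc_boundary K G (k := k.+1)) c).
have := diff_diff_cell (lepm_refl (label G c)).
by rewrite cell_label /= => ->; rewrite scaler0.
Qed.

End SquareZero.

(** * Splitting the last block *)

(* Splits on innermost conditions first, so that [lia] sees no nested [if].     *)
Ltac case_ifs :=
  repeat match goal with
  | |- context [if ?b then _ else _] =>
      lazymatch b with
      | context [if _ then _ else _] => fail
      | _ => let E := fresh in destruct b eqn:E
      end
  end.

Section SplitLast.
Variables (n : nat).
Implicit Types (A : {set 'I_n}).

(** When the lower blocks lie in [A], this puts [A] on top of the flag; it is [None] if one of the
    two parts of the last block would be empty. *)
Definition split_last k (c : cyc n k.+1) A : option (cyc n k.+2) :=
  cyc_of k.+2 (fun i => if (blk c i < k)%N then blk c i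
                        else if i \in A then k else k.+1).

Lemma blk_split k (c : cyc n k.+1) A c' : split_last c A = Some c' ->
  forall i, blk c' i = if (blk c i < k)%N then blk c i
                       else if i \in A then k else k.+1.
Proof. by move=> /blk_cyc_of. Qed.

Lemma split_lastN k (c : cyc n k.+1) A : sink_free A ->
  split_last c A = None -> forall i, blk c i = k -> i \notin A.
Proof.
move=> /forall_inP sA sN i ik; apply/negP => iA.
have /is_cycP[_ _ _ [x _ xn]] := valP c.
suff [c' c'E] : exists c', split_last c A = Some c' by rewrite sN in c'E.
apply: (@cyc_of_some _ _ _ x) => //.
- by move=> j; do !case: ifP; lia.
- move=> s sk; have [sk'|ks] := ltnP s k.
    by have [j js] := blk_surj c (ltnW sk'); exists j; rewrite js sk'.
  have [->|sk1] := eqVneq s k; first by exists i; rewrite ik ltnn iA.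
  exists x; rewrite (blk_last c xn) ltnn; case: ifP => [/sA|_]; last by lia.
  by rewrite xn eqxx.
- move=> j jn; rewrite (blk_last c jn) ltnn; case: ifP => // /sA.
  by rewrite jn eqxx.
Qed.

Lemma merge_split k (c : cyc n k.+1) A c' :
  split_last c A = Some c' -> merge c' ord_max = c.
Proof.
move=> /blk_split c'E; apply: blk_inj => i; rewrite blk_merge c'E /=.
by have := blk_le c i; case_ifs; lia.
Qed.

Lemma split_merge k (c : cyc n k.+2) A c' (s : 'I_k.+1) :
  (forall i, (blk c i < k.+1)%N -> i \in A) -> split_last c A = Some c' ->
  split_last (merge c s) A = Some (merge c' (widen_ord (leqnSn _) s)).
Proof.
move=> lowA /blk_split c'E; apply: blkK => i; rewrite !blk_merge c'E /=.
by have := lowA i; have := blk_le c i; have := leq_ord s; case_ifs; lia.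
Qed.

Lemma split_lastN_low k (c : cyc n k.+2) A : sink_free A ->
  (forall i, (blk c i < k.+1)%N -> i \in A) -> split_last c A = None ->
  forall i, (i \in A) = (blk c i < k.+1)%N.
Proof.
move=> sA lowA sN i; apply/idP/idP => [iA|]; last exact: lowA.
rewrite ltn_neqAle blk_le andbT; apply: contraL iA => /eqP.
exact: split_lastN.
Qed.

(** Here [A] is already the top of the flag. Only the face deleting it can be split by [A], and this
    restores [c]; the other faces still contain [A]. *)
Lemma split_merge_None k (c : cyc n k.+2) A (s : 'I_k.+1) :
  (forall i, (i \in A) = (blk c i < k.+1)%N) ->
  split_last (merge c s) A = if s == ord_max then Some c else None.
Proof.
move=> AE; have [->|/eqP sk] := eqVneq s ord_max.
  apply: blkK => i; rewrite blk_merge AE /=; have := blk_le c i.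
  by case_ifs; lia.
have {}sk : (s < k)%N.
  rewrite ltn_neqAle -ltnS ltn_ord andbT; apply/eqP => e; apply: sk.
  exact: val_inj.
case E: (split_last _ _) => [c'|] //; have [i] := blk_surj c' (leqnSn k).
rewrite (blk_split E) blk_merge AE.
by case_ifs; lia.
Qed.

End SplitLast.

Section LabelSplit.
Variables (n : nat) (G : digraph n).

Lemma label_split k (c : cyc n k.+1) u c' : (label G c <= u)%MM ->
  split_last c (max_legal G u) = Some c' -> (label G c' <= u)%MM.
Proof.
move=> /mnm_lepP cu /blk_split c'E; apply/mnm_lepP => i; rewrite mnmE c'E.
case: ifP => [ik|_].
  apply: leq_trans (cu i); rewrite mnmE; apply: outflowS; apply/subsetP => j.
  by rewrite !inE c'E; case: ifP => //; lia.
case: ifP => [iM|_].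
  apply: leq_trans (legalP _ _ _ (max_legal_legal G u) i iM); apply: outflowS.
  by apply/subsetP => j; rewrite !inE c'E; do !case: ifP => //; lia.
rewrite [X in outflow _ _ X](_ : _ = set0) ?outflow0 //.
by apply/setP => j; rewrite !inE c'E; do !case: ifP => //; lia.
Qed.

End LabelSplit.

(** * The contracting homotopy *)

Section DefectIdentity.
Variables (R : comNzRingType) (V : lmodType R).

Lemma scale_sign_sign k (v : V) : (-1) ^+ k *: ((-1) ^+ k *: v) = v.
Proof. by rewrite scalerA -expr2 sqrr_sign scale1r. Qed.

Lemma defect_identity k (e y z t : V) :
  e - (-1) ^+ k.+1 *: (y + (-1) ^+ k.+1 *: e - z) - ((-1) ^+ k *: y - t)
  = (-1) ^+ k.+1 *: z + t.
Proof.
rewrite scalerBr scalerDr scale_sign_sign exprS mulN1r !scaleNr.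
set a := _ *: y; set b := _ *: z.
rewrite opprK opprD opprD opprK addrA [e + (a - e)]addrCA subrr addr0 opprB.
by rewrite [a - b]addrC addrACA subrr addr0.
Qed.

End DefectIdentity.

Section Homotopy.
Variables (K : fieldType) (n : nat) (G : digraph n).
Local Notation R := {mpoly K[n]}.

Definition contract_cell k (c : cyc n k.+1) u : {ffun cyc n k.+2 -> R^o} :=
  if split_last c (max_legal G u) is Some c' then (-1) ^+ k *: cell K G c' u
  else 0.

Definition contract k (f : {ffun cyc n k.+1 -> R^o}) : {ffun cyc n k.+2 -> R^o} :=
  monomial_ext (fun c m => contract_cell c (m + label G c)) f.

HB.instance Definition _ k :=
  GRing.isZmodMorphism.Build {ffun cyc n k.+1 -> R^o} {ffun cyc n k.+2 -> R^o}
    (@contract k) (monomial_ext_is_additive _).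

Lemma contract_cellE k (c : cyc n k.+1) u : (label G c <= u)%MM ->
  contract (cell K G c u) = contract_cell c u.
Proof. by move=> cu; rewrite cell.unlock /contract monomial_ext_monomial submK. Qed.

Lemma contract_diff k (c : cyc n k.+2) u : (label G c <= u)%MM ->
  contract (cyc_diff K G k (cell K G c u))
  = \sum_(s < k.+1) (-1) ^+ s *: contract_cell (merge c s) u
    - contract_cell (wrap c) (fire G u (first_block c)).
Proof.
move=> cu; rewrite cell_diff // raddfB raddf_sum /= (contract_cellE (label_wrap_le cu)).
have e (s : 'I_k.+1) : contract ((-1) ^+ s *: cell K G (merge c s) u)
    = (-1) ^+ s *: contract_cell (merge c s) u.
  by rewrite raddfZsign /= (contract_cellE (lepm_trans (label_merge_le _ _ _) cu)).
by rewrite (eq_bigr _ (fun s _ => e s)).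
Qed.

(** The two wrap-around contributions: wrapping after the cone, and the cone after wrapping. *)
Definition defect k (c : cyc n k.+2) u : {ffun cyc n k.+2 -> R^o} :=
  (if split_last c (max_legal G u) is Some c' then
     (-1) ^+ k.+1 *: cell K G (wrap c') (fire G u (first_block c'))
   else 0) + contract_cell (wrap c) (fire G u (first_block c)).

Lemma defectE k (c : cyc n k.+2) u : (label G c <= u)%MM ->
  cell K G c u - cyc_diff K G k.+1 (contract (cell K G c u))
  - contract (cyc_diff K G k (cell K G c u)) = defect c u.
Proof.
move=> cu; rewrite contract_diff // contract_cellE // /contract_cell /defect.
have lowM i : (blk c i < k.+1)%N -> i \in max_legal G u.
  exact: lower_blocks_max_legal.
case E: (split_last c _) => [c'|]; last first.
  (* The flag already contains the apex, so the homotopy kills the cell, and the cell is recovered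
     from its last merging face. *)
  have ME := split_lastN_low (max_legal_sink_free G u) lowM E.
  rewrite big_ord_recr /= split_merge_None // eqxx scale_sign_sign.
  rewrite big1 => [|s _]; last first.
    rewrite split_merge_None // -(inj_eq val_inj) /= ltn_eqF ?ltn_ord //.
    by rewrite scaler0.
  by rewrite linear0 subr0 add0r opprB addrCA subrr addr0 add0r.
have c'u := label_split cu E; rewrite linearZ cell_diff // big_ord_recr /=.
rewrite (merge_split E).
have e (s : 'I_k.+1) : (-1) ^+ s *:
    (if split_last (merge c s) (max_legal G u) is Some c'' then
       (-1) ^+ k *: cell K G c'' u else 0)
    = (-1) ^+ k *: ((-1) ^+ s *: cell K G (merge c' (widen_ord (leqnSn k.+1) s)) u).
  by rewrite (split_merge _ lowM E) !scalerA mulrC.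
by rewrite (eq_bigr _ (fun s _ => e s)) -scaler_sumr defect_identity.
Qed.

End Homotopy.

(** * Termination of firing *)

Section Termination.
Variables (n : nat) (G : digraph n).
Implicit Types (u : 'X_{1..n}) (z : 'I_n -> nat).

(** Every sequence of legal firings of nonempty sink-free sets from [u] has fewer than [r] steps. *)
Fixpoint terminates r u : Prop :=
  if r is r'.+1 then
    forall A, [/\ A != set0, sink_free A & legal G u A] -> terminates r' (fire G u A)
  else False.

Definition outdeg i := outflow G i setT.
Definition inflow z i : nat := \sum_j weight G i j * z j.
(* z counts how often each vertex is fired, starting from u.                    *)
Definition feasible u z :=
  (forall i : 'I_n, i.+1 = n -> z i = 0%N) /\
  (forall i, outdeg i * z i <= u i + inflow z i)%N.

Definition fire_vec u z : 'X_{1..n} :=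
  [multinom u i + inflow z i - outdeg i * z i | i < n]%N.

Lemma outdegE (A : {set 'I_n}) i :
  outdeg i = (outflow G i A + outflow G i (~: A))%N.
Proof. by rewrite -outflowU ?setUCr // -setI_eq0 setICr. Qed.

Lemma inflowD z (A : {set 'I_n}) i :
  inflow (fun j => z j + (j \in A))%N i = (inflow z i + outflow G i A)%N.
Proof.
rewrite /inflow /outflow [X in (_ + X)%N]big_mkcond -big_split /=.
by apply: eq_bigr => j _; rewrite mulnDr; case: (j \in A); rewrite ?muln1 ?muln0.
Qed.

Lemma fire_vec_legal u z (A : {set 'I_n}) :
  feasible u z -> legal G (fire_vec u z) A ->
  forall i, (outdeg i * (z i + (i \in A))
             <= u i + inflow (fun j => z j + (j \in A))%N i)%N.
Proof.
case=> _ fz /legalP lA i; rewrite inflowD mulnDr; have := fz i; have := lA i.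
rewrite mnmE (outdegE A); case: (i \in A) => [/(_ isT)|_]; rewrite ?muln1 ?muln0; lia.
Qed.

Lemma fire_fire_vec u z (A : {set 'I_n}) : feasible u z -> legal G (fire_vec u z) A ->
  fire G (fire_vec u z) A = fire_vec u (fun j => z j + (j \in A))%N.
Proof.
case=> _ fz /legalP lA; apply/mnmP => i; rewrite !mnmE inflowD mulnDr.
have := fz i; have := lA i.
rewrite mnmE (outdegE A); case: (i \in A) => [/(_ isT)|_]; rewrite ?muln1 ?muln0; lia.
Qed.

(** Each nonempty firing raises the total firing count, which [B] bounds. *)
Lemma terminates_fire_vec u B : (forall z, feasible u z -> \sum_i z i <= B)%N ->
  forall r z, feasible u z -> (B < r + \sum_i z i)%N -> terminates r (fire_vec u z).
Proof.
move=> zB; elim=> [|r IHr] z fz; first by have := zB z fz; rewrite add0n; lia.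
move=> Br A [/set0Pn[i0 iA] /forall_inP sA lA]; rewrite fire_fire_vec //.
apply: IHr; last first.
  apply: leq_trans Br _; rewrite addSnnS leq_add2l.
  rewrite big_split (bigD1 i0) //= (bigD1 i0 (F := fun i => nat_of_bool _)) //= iA.
  by lia.
split; last exact: fire_vec_legal.
move=> i ni; have [fz0 _] := fz; rewrite (fz0 _ ni) add0n.
by case: (boolP (i \in A)) => // /sA; rewrite ni eqxx.
Qed.

(** A vertex fired almost [M] times must be refilled by its out-neighbours. None of these exceeds
    [M], so each must itself be close to [M]. *)
Lemma arc_bound u z M C j k : feasible u z -> (forall i, z i <= M)%N -> arc G j k ->
  (M <= z j + C -> M <= z k + (u j + outdeg j * C))%N.
Proof.
case=> _ /(_ j) fz zM; rewrite /arc /= => wjk MC.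
pose o := (\sum_(l | l != k) weight G j l)%N.
pose s := (\sum_(l | l != k) weight G j l * z l)%N.
have oE : outdeg j = (weight G j k + o)%N.
  rewrite /outdeg /outflow (bigD1 k) ?inE //=; congr addn.
  by apply: eq_bigl => l; rewrite inE.
have sE : inflow z j = (weight G j k * z k + s)%N by rewrite /inflow (bigD1 k).
have so : (s <= o * M)%N.
  by rewrite big_distrl; apply: leq_sum => l _; rewrite leq_mul2l zM orbT.
rewrite leqNgt; apply/negP => zk; move: fz; rewrite sE oE in zk *.
have : ((weight G j k + o) * M <= (weight G j k + o) * (z j + C))%N.
  by rewrite leq_mul2l MC orbT.
by nia.
Qed.

Lemma path_bound u p (j : 'I_n) : path (arc G) j p -> (last j p).+1 = n ->
  forall C, exists B, forall z M, feasible u z -> (forall i, z i <= M)%N ->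
  (M <= z j + C -> M <= B)%N.
Proof.
elim: p j => [|k p IHp] j /=.
  by move=> _ jn C; exists C => z M [fz _] _; rewrite (fz j jn).
case/andP=> jk kp kn C; have [B hB] := IHp k kp kn (u j + outdeg j * C)%N.
by exists B => z M fz zM MC; apply: (hB z M fz zM); apply: arc_bound MC.
Qed.

Lemma feasible_bounded u : strongly_connected G ->
  exists B, forall z, feasible u z -> (\sum_i z i <= B)%N.
Proof.
move=> sc.
have ex_bound (j : 'I_n) : exists B, forall z M, feasible u z ->
    (forall i, z i <= M)%N -> (M <= z j -> M <= B)%N.
  have n0 : (n.-1 < n)%N by rewrite ltn_predL (leq_ltn_trans _ (ltn_ord j)).
  have jt : connect (arc G) j (Ordinal n0).
    have [->|] := eqVneq j (Ordinal n0); [exact: connect0 | exact: sc].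
  have /connectP[p pj pl] := jt.
  (* The slack is 0 at a vertex where [z] is maximal; it grows along the path to the last vertex,
     where [z] vanishes. *)
  have [|B hB] := path_bound u pj _ 0; first by rewrite -pl /= prednK //; lia.
  by exists B => z M fz zM Mz; apply: (hB z M) => //; rewrite addn0.
have [B hB] := choice ex_bound.
exists (\sum_(i < n) \sum_j B j)%N => z fz; apply: leq_sum => i _.
case: (@arg_maxnP _ i predT z isT) => i0 _ zi0.
have zM j : (z j <= z i0)%N by apply: zi0.
apply: leq_trans (zM i) (leq_trans (hB i0 z _ fz zM (leqnn _)) _).
by rewrite (bigD1 i0) //= leq_addr.
Qed.

Lemma terminates_ex u : strongly_connected G -> exists r, terminates r u.
Proof.
move=> /(feasible_bounded u)[B hB]; exists B.+1.
have f0 : feasible u (fun=> 0%N) by split=> // i; rewrite muln0.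
have -> : u = fire_vec u (fun=> 0%N).
  apply/mnmP => i; rewrite mnmE muln0 subn0 /inflow big1 ?addn0 // => j _.
  by rewrite muln0.
by apply: (terminates_fire_vec hB f0); rewrite addSn ltnS leq_addr.
Qed.

Lemma terminatesS r s u : (r <= s)%N -> terminates r u -> terminates s u.
Proof.
elim: r s u => [|r IHr] [|s] u //= rs tu A lA.
by apply: IHr (tu A lA).
Qed.

End Termination.

(** * Acyclicity in positive degrees *)

Section Acyclicity.
Variables (K : fieldType) (n : nat) (G : digraph n).
Local Notation R := {mpoly K[n]}.
Implicit Types (P Q : 'X_{1..n} -> Prop).

Definition based k P (f : {ffun cyc n k -> R^o}) : Prop :=
  forall c m, m \in msupp (f c : R) -> P (m + label G c)%MM.

Lemma based0 k P : @based k P 0.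
Proof. by move=> c m; rewrite ffunE msupp0. Qed.

Lemma basedD k P (f g : {ffun cyc n k -> R^o}) :
  based P f -> based P g -> based P (f + g).
Proof.
move=> fP gP c m; rewrite ffunE => /(@msuppD_le _ _ (f c : R) (g c : R)).
by rewrite mem_cat => /orP[/fP|/gP].
Qed.

Lemma basedZ k P (a : K) (f : {ffun cyc n k -> R^o}) :
  based P f -> based P (a%:MP *: f).
Proof.
move=> fP c m; rewrite ffunE; set p : R := f c; rewrite [_ *: _]/(a%:MP * p).
rewrite mcoeff_msupp mcoeffCM => ap; apply: (fP c m).
by rewrite mcoeff_msupp; apply: contraNneq ap => ->; rewrite mulr0.
Qed.

Lemma based_sign k P i (f : {ffun cyc n k -> R^o}) :
  based P f -> based P ((-1) ^+ i *: f).
Proof.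
have -> : (-1) ^+ i = ((-1) ^+ i)%:MP :> R.
  by rewrite rmorphXn rmorphN rmorph1.
exact: basedZ.
Qed.

Lemma based_cell k P (c : cyc n k) u :
  (label G c <= u)%MM -> P u -> based P (cell K G c u).
Proof.
move=> cu Pu c' m; rewrite cell.unlock.
have -> : ('X_[u - label G c] *: basis_vec R c) c'
    = 'X_[u - label G c] * (c' == c)%:R :> R by rewrite !ffunE.
have [->|_] := eqVneq c' c; last by rewrite mulr0 msupp0.
by rewrite mulr1 msuppX inE => /eqP->; rewrite submK.
Qed.

Lemma based_monomial_ext k l P Q g (f : {ffun cyc n k -> R^o}) :
  (forall c m, P (m + label G c)%MM -> based Q (g c m)) -> based P f ->
  based Q (monomial_ext g f : {ffun cyc n l -> R^o}).
Proof.
move=> gQ fP; rewrite /monomial_ext.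
elim/big_ind: _ => [||c _]; [exact: based0 | exact: basedD |].
rewrite big_seq; elim/big_ind: _ => [||m /fP]; [exact: based0 | exact: basedD |].
by move=> Pm; apply: basedZ; apply: gQ.
Qed.

Lemma based_contract_cell k P (c : cyc n k.+1) u :
  (label G c <= u)%MM -> P u -> based P (contract_cell K G c u).
Proof.
move=> cu Pu; rewrite /contract_cell.
case E: split_last => [c'|]; last exact: based0.
by apply: based_sign; apply: based_cell; rewrite ?(label_split cu E).
Qed.

Lemma based_defect r k (c : cyc n k.+2) u : (label G c <= u)%MM ->
  terminates G r.+1 u -> based (terminates G r) (defect K G c u).
Proof.
move=> cu tu; apply: basedD; last first.
  apply: based_contract_cell; first exact: label_wrap_le.
  exact: tu (first_block_legal cu).
case E: split_last => [c'|]; last exact: based0.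
have c'u := label_split cu E.
apply: based_sign; apply: based_cell; first exact: label_wrap_le.
exact: tu (first_block_legal c'u).
Qed.

Lemma defect_ext k (f : {ffun cyc n k.+2 -> R^o}) :
  f - cyc_diff K G k.+1 (contract G f) - contract G (cyc_diff K G k f)
  = monomial_ext (fun c m => defect K G c (m + label G c)) f.
Proof.
have cellE c m : cell K G c (m + label G c)%MM = 'X_[m] *: basis_vec R c.
  by rewrite cell.unlock addmK.
pose g (c : cyc n k.+2) m := cell K G c (m + label G c)%MM.
have fE : f = monomial_ext g f.
  by rewrite -[LHS]monomial_ext_id; congr (monomial_ext _ f);
    do 2!apply: funext => ?; rewrite /g cellE.
have dE : cyc_diff K G k.+1 (contract G f)
    = monomial_ext (fun c m => cyc_diff K G k.+1 (contract G (g c m))) f.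
  rewrite {1}fE.
  apply: (@monomial_ext_comp _ _ _ _ _ (cyc_diff K G k.+1 \o @contract K n G k.+1)).
  by move=> a v; rewrite /= /contract monomial_extZ linearZ.
have hE : contract G (cyc_diff K G k f)
    = monomial_ext (fun c m => contract G (cyc_diff K G k (g c m))) f.
  rewrite {1}fE.
  apply: (@monomial_ext_comp _ _ _ _ _ (@contract K n G k \o cyc_diff K G k)).
  by move=> a v; rewrite /= linearZ /contract monomial_extZ.
rewrite dE hE {1}fE !monomial_ext_sub; congr (monomial_ext _ f).
by do 2!apply: funext => ?; rewrite /g defectE ?lem_addl.
Qed.

Lemma acyclic_based r k (f : {ffun cyc n k.+2 -> R^o}) :
  based (terminates G r) f -> cyc_diff K G k f = 0 ->
  exists g, cyc_diff K G k.+1 g = f.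
Proof.
elim: r f => [|r IHr] f fb df.
  exists 0; rewrite linear0; apply/ffunP => c; rewrite ffunE.
  apply/esym/mpolyP => m; rewrite mcoeff0; apply/eqP; rewrite mcoeff_eq0.
  by apply/negP => /fb.
pose f' := f - cyc_diff K G k.+1 (contract G f).
have [||g' g'E] := IHr f'.
- have -> : f' = monomial_ext (fun c m => defect K G c (m + label G c)) f.
    by rewrite -defect_ext df raddf0 subr0.
  by apply: based_monomial_ext fb => c m; apply: based_defect; apply: lem_addl.
- by rewrite linearB /= df diff_diff subrr.
by exists (g' + contract G f); rewrite linearD /= g'E subrK.
Qed.

Lemma cyc_acyclic k (f : {ffun cyc n k.+2 -> R^o}) : strongly_connected G ->
  cyc_diff K G k f = 0 -> exists g, cyc_diff K G k.+1 g = f.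
Proof.
move=> sc; have [r rE] := choice (fun u => terminates_ex u sc).
(* The sum over the finitely many cells of [f] dominates each of their bounds. *)
apply: (@acyclic_based (\sum_c \sum_(m <- msupp (f c : R)) r (m + label G c)%MM)%N).
move=> c m mf; apply: terminatesS (rE _).
by rewrite (bigD1 c) //= (big_rem m) //= -addnA leq_addr.
Qed.

End Acyclicity.

(** * The lattice ideal *)

Lemma two_blocks n (A : {set 'I_n}) : A != set0 -> sink_free A ->
  exists c : cyc n 2, forall i, blk c i = (i \notin A).
Proof.
move=> /set0Pn[i0 iA] /forall_inP sA.
have n0 : (n.-1 < n)%N by rewrite ltn_predL (leq_ltn_trans _ (ltn_ord i0)).
have xn : (Ordinal n0).+1 = n by rewrite /= prednK // -ltn_predL.
have last_notin (i : 'I_n) : i.+1 = n -> i \notin A.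
  by move=> ni; apply/negP => /sA; rewrite ni eqxx.
have [||||c cE] := @cyc_of_some n 1 (fun i => i \notin A) (Ordinal n0).
- by move=> i; case: (i \in A).
- case=> [|[|s]] // _; first by exists i0; rewrite iA.
  by exists (Ordinal n0); rewrite last_notin.
- exact: xn.
- by move=> i /last_notin ->.
by exists c; apply: blk_cyc_of cE.
Qed.

Lemma cyc_blocks_le n k : cyc n k.+1 -> (k < n)%N.
Proof.
move=> c; have [g gE] := choice (fun s : 'I_k.+1 => blk_surj c (leq_ord s)).
rewrite -[X in (X <= _)%N]card_ord -[X in (_ <= X)%N]card_ord.
by apply: (leq_card g) => s t e; apply: val_inj; rewrite /= -!gE e.
Qed.

Section Augmentation.
Variables (K : fieldType) (n : nat) (G : digraph n).
Local Notation R := {mpoly K[n]}.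
Local Notation L := (laplacian G).

Lemma cyc1_eq (c c' : cyc n 1) : c = c'.
Proof. by apply: val_inj; rewrite /= !cyc1_blocks. Qed.

Lemma cyc0_polyE (f : {ffun cyc n 1 -> R^o}) c : cyc0_poly f = f c.
Proof.
rewrite /cyc0_poly (bigD1 c) //= big1 ?addr0 // => c' /eqP nc.
by case: nc; apply: cyc1_eq.
Qed.

Lemma cyc0_poly_is_linear : linear (@cyc0_poly K n : _ -> R^o).
Proof.
move=> a f g; rewrite /cyc0_poly scaler_sumr -big_split.
by apply: eq_bigr => c _; rewrite !ffunE.
Qed.

HB.instance Definition _ :=
  GRing.isLinear.Build R {ffun cyc n 1 -> R^o} R^o _ (@cyc0_poly K n : _ -> R^o)
    cyc0_poly_is_linear.

Lemma label1 (c : cyc n 1) : label G c = 0%MM.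
Proof.
apply/mnmP => i; rewrite !mnmE [X in outflow _ _ X](_ : _ = set0) ?outflow0 //.
by apply/setP => j; rewrite !inE; have := blk_le c j; lia.
Qed.

Lemma cyc0_poly_cell (c : cyc n 1) u : cyc0_poly (cell K G c u) = 'X_[u].
Proof.
rewrite (cyc0_polyE _ c) cell.unlock label1 subm0.
by rewrite !ffunE eqxx [LHS]mulr1.
Qed.

Lemma cyc0_poly_diff_cell (c : cyc n 2) u : (label G c <= u)%MM ->
  cyc0_poly (cyc_diff K G 0 (cell K G c u))
  = 'X_[u] - 'X_[fire G u (first_block c)].
Proof.
move=> cu; rewrite cell_diff // linearB /= big_ord1 scale1r.
by rewrite !cyc0_poly_cell.
Qed.

Definition is_boundary (p : R) : Prop :=
  exists a, cyc0_poly (cyc_diff K G 0 a) = p.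

Lemma is_boundary_fire u (A : {set 'I_n}) :
  legal G u A -> is_boundary ('X_[u] - 'X_[fire G u A]).
Proof.
have trivial_firing B : (forall i, fire G u B i = u i) ->
    is_boundary ('X_[u] - 'X_[fire G u B]).
  move=> Bu; exists 0; rewrite !linear0; have -> : fire G u B = u by apply/mnmP.
  by rewrite subrr.
have [->|A0] := eqVneq A set0.
  by move=> _; apply: trivial_firing => i; rewrite mnmE inE outflow0 addn0.
have [->|AT] := eqVneq A setT.
  by move=> _; apply: trivial_firing => i; rewrite mnmE inE setCT outflow0 subn0.
move=> lA; have [sA|] := boolP (sink_free A).
  have [c cE] := two_blocks A0 sA; exists (cell K G c u).
  have -> : A = first_block c by apply/setP => i; rewrite inE cE; case: (i \in A).
  apply: cyc0_poly_diff_cell; apply/mnm_lepP => i; rewrite mnmE cE.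
  have [iA|_] := boolP (i \in A); last first.
    rewrite [X in outflow _ _ X](_ : _ = set0) ?outflow0 //.
    by apply/setP => j; rewrite !inE cE; case: (j \in A).
  apply: leq_trans (legalP _ _ _ lA i iA); apply: outflowS.
  by apply/subsetP => j; rewrite !inE cE; case: (j \in A).
rewrite negb_forall_in => /existsP[t /andP[tA /negbNE/eqP tn]].
have sC : sink_free (~: A).
  apply/forall_inP => i; rewrite inE; apply: contraNN => /eqP ni.
  suff -> : i = t by []; apply: val_inj; apply: succn_inj; rewrite /= ni; exact/esym/tn.
have C0 : ~: A != set0 by apply: contraNneq AT => e; rewrite -(setCK A) e setC0.
have [c cE] := two_blocks C0 sC.
(* If [A] contains the last vertex, firing the complement of [A] from [v] leads back to [u], and
   gives the same binomial up to sign. *)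
pose v := fire G u A.
have cF : first_block c = ~: A.
  by apply/setP => i; rewrite !inE cE inE; case: (i \in A).
have cv : (label G c <= v)%MM.
  apply/mnm_lepP => i; rewrite mnmE cE inE negbK mnmE.
  have [iA|_] := boolP (i \in A).
    rewrite [X in outflow _ _ X](_ : _ = set0) ?outflow0 //.
    by apply/setP => j; rewrite !inE cE inE; case: (j \in A).
  apply: leq_trans (leq_addl _ _); apply: outflowS.
  by apply/subsetP => j; rewrite !inE cE inE; case: (j \in A).
exists (- cell K G c v); rewrite !linearN /= cyc0_poly_diff_cell // cF fireU //.
  rewrite setUCr opprB; have -> // : fire G u setT = u.
  by apply/mnmP => i; rewrite mnmE inE setCT outflow0 subn0.
by rewrite -setI_eq0 setICr.
Qed.

Lemma is_boundaryD p q : is_boundary p -> is_boundary q -> is_boundary (p + q).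
Proof. by case=> a <- [b <-]; exists (a + b); rewrite !linearD. Qed.

Lemma is_boundary_equiv (u v : 'X_{1..n}) (z : 'I_n -> nat) :
  (forall i, u i + inflow G z i = v i + outdeg G i * z i)%N ->
  is_boundary ('X_[u] - 'X_[v]).
Proof.
have [D] : exists D, forall i, (z i <= D)%N.
  by exists (\sum_i z i)%N => i; rewrite (bigD1 i) //= leq_addr.
elim: D u z => [|D IHD] u z zD uv.
  exists 0; rewrite !linear0; have -> : u = v; last by rewrite subrr.
  apply/mnmP => i; have := uv i; rewrite /inflow big1 ?addn0 => [->|j _].
    by have := zD i; rewrite leqn0 => /eqP->; rewrite muln0 addn0.
  by have := zD j; rewrite leqn0 => /eqP->; rewrite muln0.
(* At a vertex of [A] the inflow from [z'] is at most [outdeg G i * D], so [u] itself must cover the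
   outflow to the complement: [A] is legal. *)
pose A := [set i | z i == D.+1]; pose z' i := (z i - (i \in A))%N.
have zE i : (z i = z' i + (i \in A))%N.
  by rewrite /z' subnK // inE; case: eqP => // ->.
have z'D i : (z' i <= D)%N.
  by have := zD i; rewrite /z' inE; case: eqP => [->|] /=; lia.
have infE i : inflow G z i = (inflow G z' i + outflow G i A)%N.
  by rewrite -inflowD /inflow; apply: eq_bigr => j _; rewrite zE.
have inf_le i : (inflow G z' i <= outdeg G i * D)%N.
  rewrite /inflow /outdeg /outflow big_distrl /=.
  rewrite [leqRHS](eq_bigl predT) => [|j]; last by rewrite inE.
  by apply: leq_sum => j _; rewrite leq_mul2l z'D orbT.
have lA : legal G u A.
  apply/legalP => i iA; have := uv i; rewrite infE.
  have -> : z i = D.+1 by move: iA; rewrite inE => /eqP.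
  by have := inf_le i; rewrite (outdegE G A) mulnS; lia.
rewrite -(subrKA 'X_[fire G u A]); apply: is_boundaryD.
  exact: is_boundary_fire.
apply: (IHD _ z') => // i; have := uv i; rewrite infE zE mnmE mulnDr (outdegE G A).
have /legalP/(_ i) := lA; have := inf_le i.
by case: (i \in A) => [_ /(_ isT)|_ _]; rewrite ?muln1 ?muln0; lia.
Qed.

End Augmentation.

Section LatticeIdeal.
Variables (K : fieldType) (n : nat) (G : digraph n).
Local Notation R := {mpoly K[n]}.
Local Notation L := (laplacian G).

Lemma outdeg_sum i : (\sum_j weight G i j)%N = outdeg G i.
Proof. by rewrite /outdeg /outflow; apply: eq_bigl => j; rewrite inE. Qed.

Lemma mul_laplacian (z : 'cV[int]_n) i :
  (L *m z) i ord0 = (outdeg G i)%:Z * z i ord0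
    - \sum_j (weight G i j)%:Z * z j ord0.
Proof.
rewrite mxE (bigD1 i) //= [in RHS](bigD1 i) //= no_loop mul0r add0r mxE eqxx.
rewrite -(outdeg_sum i) [in RHS](bigD1 i) //= no_loop add0n -sumrN; congr (_ + _).
by apply: eq_bigr => j ji; rewrite mxE eq_sym (negPf ji) mulNr.
Qed.

Lemma mul_laplacian_nat (z : 'I_n -> nat) i :
  (L *m (\col_j (z j)%:Z)) i ord0 = (outdeg G i * z i)%N%:Z - (inflow G z i)%:Z.
Proof.
rewrite mul_laplacian mxE PoszM; congr (_ - _).
rewrite /inflow -[RHS]natz natr_sum; apply: eq_bigr => j _.
by rewrite mxE natz PoszM.
Qed.

Lemma column_lattice_nat (l : 'cV[int]_n) : column_lattice L l ->
  exists z : 'I_n -> nat, l = L *m (\col_j (z j)%:Z).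
Proof.
case=> z ->; pose b := (\sum_j absz (z j ord0))%N.
have zb j : 0 <= z j ord0 + b%:Z.
  have : (absz (z j ord0) <= b)%N by rewrite /b (bigD1 j) //= leq_addr.
  by lia.
(* Rows of the Laplacian sum to zero, so adding the constant [b] to all entries changes nothing. *)
exists (fun j => absz (z j ord0 + b%:Z)); apply/colP => i; rewrite !mul_laplacian.
rewrite mxE gez0_abs // mulrDr.
under [in RHS]eq_bigr => j _ do rewrite mxE gez0_abs // mulrDr.
rewrite big_split /= -mulr_suml opprD addrACA.
have -> : \sum_j (weight G i j)%:Z = (outdeg G i)%:Z.
  by rewrite -outdeg_sum -[RHS]natz natr_sum; apply: eq_bigr => j _; rewrite natz.
by rewrite subrr addr0.
Qed.

Lemma lattice_binomialE (l : 'cV[int]_n) :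
  lattice_binomial K l = 'X_[[multinom absz (Num.max (l i ord0) 0) | i < n]]
    - 'X_[[multinom absz (- Num.min (l i ord0) 0) | i < n]].
Proof.
by rewrite !mpolyXE_id; congr (_ - _); apply: eq_bigr => i _; rewrite mnmE.
Qed.

Lemma lattice_binomial_is_boundary l :
  column_lattice L l -> is_boundary G (lattice_binomial K l).
Proof.
move=> /column_lattice_nat[z lE]; rewrite lattice_binomialE.
apply: (@is_boundary_equiv _ _ _ _ _ z) => i; rewrite !mnmE.
have : l i ord0 = (outdeg G i * z i)%N%:Z - (inflow G z i)%:Z.
  by rewrite lE mul_laplacian_nat.
by case: (leP (l i ord0) 0); lia.
Qed.

Lemma lattice_ideal_binomial l :
  column_lattice L l -> lattice_binomial K l \in lattice_ideal K L.
Proof.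
move=> lL; apply/asboolP; exists 1%N, (fun=> 1), (fun=> lattice_binomial K l).
by split=> [_|]; [exists l | rewrite big_ord1 mul1r].
Qed.

(** The label of [(A, ~: A)] is the positive part of the Laplacian applied to the indicator of [A],
    and firing [A] turns it into the negative part. *)
Lemma boundary_binomial (c : cyc n 2) :
  cyc0_poly (cyc_diff K G 0 (basis_vec R c)) \in lattice_ideal K L.
Proof.
rewrite -(cell_label K G c) cyc0_poly_diff_cell ?lepm_refl //.
pose z (i : 'I_n) := nat_of_bool (i \in first_block c).
suff -> : 'X_[label G c] - 'X_[fire G (label G c) (first_block c)]
    = lattice_binomial K (L *m (\col_j (z j)%:Z)).
  by apply: lattice_ideal_binomial; eexists.
have zE i : inflow G z i = outflow G i (first_block c).
  rewrite /inflow /outflow [RHS]big_mkcond; apply: eq_bigr => j _; rewrite /z.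
  by case: (j \in _); rewrite ?muln1 ?muln0.
have labelE i : label G c i =
    if i \in first_block c then outflow G i (~: first_block c) else 0%N.
  rewrite mnmE inE; have := blk_le c i; case: eqP => [->|ci] ci1.
    by congr outflow; apply/setP => j; rewrite !inE lt0n.
  rewrite [X in outflow _ _ X](_ : _ = set0) ?outflow0 //.
  by apply/setP => j; rewrite !inE; have := blk_le c j; lia.
rewrite lattice_binomialE; congr ('X_[_] - 'X_[_]); apply/mnmP => i;
  rewrite [in RHS]mnmE mul_laplacian_nat zE /z (outdegE G (first_block c)).
  by rewrite labelE; case: ifP => _; lia.
by rewrite mnmE labelE; case: (i \in first_block c); lia.
Qed.

Lemma boundary_in_lattice_ideal a :
  cyc0_poly (cyc_diff K G 0 a) \in lattice_ideal K L.
Proof.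
rewrite -[cyc_diff K G 0 a]/(free_ext _ _) /free_ext linear_sum.
apply: rpred_sum => c _; rewrite linearZ -(free_ext_basis (cyc_boundary K G (k := 0)) c).
exact: idealMr (boundary_binomial c).
Qed.

Lemma lattice_ideal_is_boundary p :
  p \in lattice_ideal K L -> is_boundary G p.
Proof.
move=> /asboolP[m [a [g [gL ->]]]]; elim/big_ind: _ => [||i _].
- by exists 0; rewrite !linear0.
- exact: is_boundaryD.
have [l lL ->] := gL i; have [b bE] := lattice_binomial_is_boundary lL.
by exists (a i *: b); rewrite !linearZ /= bE.
Qed.

Lemma cyc_proj_eq0 f : cyc_proj G f = 0 <-> cyc0_poly f \in lattice_ideal K L.
Proof.
rewrite /cyc_proj -(rmorph0 \pi_({ideal_quot (lattice_ideal K L)})).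
split=> [/eqP|fL].
  by rewrite -Quotient.idealrBE subr0.
by apply/eqP; rewrite -Quotient.idealrBE subr0.
Qed.

End LatticeIdeal.

Lemma top_diff_injective (K : fieldType) l (G : digraph l.+2) :
  strongly_connected G -> injective (cyc_diff K G l).
Proof.
move=> sc; apply: raddf_inj => f df; have [g <-] := cyc_acyclic sc df.
rewrite (_ : g = 0) ?linear0 //; apply/ffunP => c.
by have := cyc_blocks_le c; rewrite ltnn.
Qed.

Theorem theorem6p1 (K : fieldType) (n : nat) (G : digraph n) :
  (3 <= n)%N ->
  strongly_connected G ->
  @free_resolution {mpoly K[n]}
    {ideal_quot (lattice_ideal K (laplacian G))} n.-1
    (fun k => cyc n k.+1)
    (cyc_diff K G)
    (@cyc_proj K n G).
Proof.
move=> n3 sc.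
have n0 : (0 < n)%N by apply: leq_trans n3.
have /card_gt0P[c1 _] : (0 < #|{: cyc n 1}|)%N by rewrite card_cyc1.
split.
- move=> m; exists ((repr m : {mpoly K[n]}) *: basis_vec _ c1).
  rewrite /= /cyc_proj (cyc0_polyE _ c1) !ffunE eqxx.
  by rewrite [X in \pi X]mulr1 reprK.
- move=> _ f; split=> [/cyc_proj_eq0/lattice_ideal_is_boundary[a aE]|[a <-]].
    exists a; apply/ffunP => c; rewrite -(cyc0_polyE _ c) -[RHS](cyc0_polyE f).
    exact: aE.
  by apply/cyc_proj_eq0/boundary_in_lattice_ideal.
- move=> k _ f; split=> [|[a <-]]; first exact: cyc_acyclic.
  exact: diff_diff.
- clear c1 n0; case: n n3 G sc => [|[|l]] n3 G sc; [by []|by []|].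
  exact: top_diff_injective sc.
Qed.
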